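(* Let $M$ be a first order model, let $\phi$ be an inclusion/exclusion logic formula over the signature of $M$ and let $X$ be a team over $M$ whose domain contains all free variables of $\phi$. Then Player $II$ has a uniform winning strategy in the semantic game $G^M_X(\phi)$ if and only if $M \models_X \phi$ with respect to the lax semantics.
   Context: All first order models are assumed to have at least two elements in their domain; $\mathrm{Dom}(M)$ is the domain of $M$. An assignment over $M$ is a function from a set of variables to $\mathrm{Dom}(M)$; $s[m/x]$ sends $x$ to $m$ and otherwise agrees with $s$; $t\langle s\rangle$ is the value of the term $t$ in $M$ under $s$, and $\vec t\langle s\rangle$ is the corresponding tuple of values. A team $X$ over $M$ is a set of assignments over $M$ all having the same domain. Inclusion/exclusion (I/E) logic formulas are in negation normal form and are built from first order literals, inclusion atoms $\vec t_1 \subseteq \vec t_2$ and exclusion atoms $\vec t_1 ~|~ \vec t_2$ ($\vec t_1,\vec t_2$ finite tuples of terms of the same length) using $\wedge,\vee,\exists x,\forall x$. Lax team semantics: - for a first order literal $\phi$: $M\models_X\phi$ iff $M\models_s\phi$ (Tarski) for all $s\in X$; - $M\models_X \vec t_1\subseteq\vec t_2$ iff for every $s\in X$ there is $s'\in X$ with $\vec t_1\langle s\rangle=\vec t_2\langle s'\rangle$; - $M\models_X \vec t_1~|~\vec t_2$ iff for all $s,s'\in X$, $\vec t_1\langle s\rangle\neq\vec t_2\langle s'\rangle$; - $M\models_X\psi\vee\theta$ iff $X=Y\cup Z$ for some teams $Y,Z$ with $M\models_Y\psi$ and $M\models_Z\theta$; - $M\models_X\psi\wedge\theta$ iff $M\models_X\psi$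 and $M\models_X\theta$; - $M\models_X\exists x\psi$ iff there is $H:X\to\mathcal P(\mathrm{Dom}(M))\setminus\{\emptyset\}$ with $M\models_{X[H/x]}\psi$, where $X[H/x]=\{s[m/x]:s\in X,\ m\in H(s)\}$; - $M\models_X\forall x\psi$ iff $M\models_{X[M/x]}\psi$, where $X[M/x]=\{s[m/x]:s\in X,\ m\in\mathrm{Dom}(M)\}$. The semantic game $G^M_X(\phi)$: there are two players, $I$ and $II$. Positions are expressions $(\psi,s)$ with $\psi$ an instance (occurrence) of a subformula of $\phi$ and $s$ an assignment over $M$ whose domain contains the free variables of $\psi$. Initial positions are $(\phi,s)$ for $s\in X$. Terminal positions are $(\alpha,s)$ with $\alpha$ a first order literal, inclusion atom or exclusion atom. The successor set $S(p)$ of a non-terminal position $p=(\psi,s)$ is $\{(\theta_1,s),(\theta_2,s)\}$ if $\psi$ is $\theta_1\vee\theta_2$ or $\theta_1\wedge\theta_2$, and $\{(\theta,s[m/x]):m\in\mathrm{Dom}(M)\}$ if $\psi$ is $\exists x\theta$ or $\forall x\theta$. The active player $T(p)$ is $II$ if $\psi$ is a disjunction or existential formula, and $I$ if $\psi$ is a conjunction or universal formula. A terminal position $(\alpha,s)$ is winning for $II$ iff $\alpha$ is an inclusion or exclusion atom, or $\alpha$ is a first order literal with $M\models_s\alpha$ in the usual sense; otherwise it is winning for $I$. A play is a finite sequence $p_1\ldots p_n$ of positions with $p_1$ initial and $p_i\in S(p_{i-1})$ for $i=2,\ldots,n$; it is complete if $p_n$ is terminal, and winning for $II$ if $p_n$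 is winning for $II$. A (possibly non-deterministic) strategy for $II$ is a function $\tau$ sending each position $p$ with $T(p)=II$ to a nonempty subset $\tau(p)\subseteq S(p)$. A play follows $\tau$ if $p_{i+1}\in\tau(p_i)$ whenever $T(p_i)=II$, $i=1,\ldots,n-1$. $\tau$ is winning if all complete plays following it are winning for $II$. $\tau$ is uniform if for every complete play $p_1\ldots p_n$ following $\tau$: (1) if $p_n=(\vec t_1\subseteq\vec t_2,s)$ then there is a play $q_1\ldots q_{n'}$ following $\tau$ with $q_{n'}=(\vec t_1\subseteq\vec t_2,s')$ for the same instance of the inclusion atom and $\vec t_2\langle s'\rangle=\vec t_1\langle s\rangle$; (2) if $p_n=(\vec t_1~|~\vec t_2,s)$ then for all plays $q_1\ldots q_{n'}$ following $\tau$ with $q_{n'}=(\vec t_1~|~\vec t_2,s')$ for the same instance of the exclusion atom, $\vec t_1\langle s\rangle\neq\vec t_2\langle s'\rangle$. *)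

(* Defs.v *)
From Stdlib Require Import Arith List Ensembles.
From Stdlib Require Vector.
Import ListNotations.

Set Implicit Arguments.
Unset Strict Implicit.

Record signature := Signature {
  func : Type;
  func_arity : func -> nat;
  rel : Type;
  rel_arity : rel -> nat
}.

Record model (Sg : signature) := Model {
  Dom :> Type;
  two_elements : exists a b : Dom, a <> b;
  func_interp : forall f : func Sg, Vector.t Dom (func_arity f) -> Dom;
  rel_interp : forall R : rel Sg, Vector.t Dom (rel_arity R) -> Prop
}.

Definition var := nat.

Section Syntax.
Variable Sg : signature.

Inductive term : Type :=
| Var (x : var)
| Func (f : func Sg) (ts : Vector.t term (func_arity f)).

Inductive atom : Type :=
| Rel (R : rel Sg) (ts : Vector.t term (rel_arity R))
| Equal (t1 t2 : term).

(* [Lit true a] is the literal [a], [Lit false a] is its negation. *)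
Inductive formula : Type :=
| Lit (positive : bool) (a : atom)
| Incl (k : nat) (ts1 ts2 : Vector.t term k)
| Excl (k : nat) (ts1 ts2 : Vector.t term k)
| And (psi theta : formula)
| Or (psi theta : formula)
| Ex (x : var) (psi : formula)
| All (x : var) (psi : formula).

Inductive occurs (x : var) : term -> Prop :=
| occurs_var : occurs x (Var x)
| occurs_func (f : func Sg) (ts : Vector.t term (func_arity f)) (t : term) :
    Vector.In t ts -> occurs x t -> occurs x (Func ts).

Definition occurs_tuple (x : var) (k : nat) (ts : Vector.t term k) : Prop :=
  exists t, Vector.In t ts /\ occurs x t.

Definition occurs_atom (x : var) (a : atom) : Prop :=
  match a with
  | Rel ts => occurs_tuple x ts
  | Equal t1 t2 => occurs x t1 \/ occurs x t2
  end.

Fixpoint free (x : var) (phi : formula) : Prop :=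
  match phi with
  | Lit _ a => occurs_atom x a
  | Incl ts1 ts2 | Excl ts1 ts2 => occurs_tuple x ts1 \/ occurs_tuple x ts2
  | And psi theta | Or psi theta => free x psi \/ free x theta
  | Ex y psi | All y psi => x <> y /\ free x psi
  end.

(* An occurrence of a subformula of [phi] is the path leading to it in the
   syntax tree of [phi].  Paths are stored deepest step first, so that passing
   to an immediate subformula is [cons]. *)
Inductive step := GoLeft | GoRight | GoBody.
Definition occurrence := list step.

Definition child (d : step) (psi : formula) : option formula :=
  match d, psi with
  | GoLeft, (And theta _ | Or theta _) => Some theta
  | GoRight, (And _ theta | Or _ theta) => Some theta
  | GoBody, (Ex _ theta | All _ theta) => Some theta
  | _, _ => None
  end.

Fixpoint subformula_at (phi : formula) (o : occurrence) : option formula :=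
  match o with
  | [] => Some phi
  | d :: o' =>
      match subformula_at phi o' with
      | Some psi => child d psi
      | None => None
      end
  end.

End Syntax.

Arguments Var {Sg} x.
Arguments Func {Sg} f ts.
Arguments Rel {Sg} R ts.

Section Semantics.
Variables (Sg : signature) (M : model Sg).

(* A function from a set of variables to [Dom M] is a partial function, with
   value [None] outside its domain. *)
Definition assignment := var -> option M.

Definition update (s : assignment) (x : var) (m : M) : assignment :=
  fun y => if Nat.eq_dec y x then Some m else s y.

Definition domain (s : assignment) : Ensemble var := fun x => s x <> None.

Fixpoint all_some (A : Type) (n : nat) (v : Vector.t (option A) n) :
    option (Vector.t A n) :=
  match v with
  | Vector.nil _ => Some (Vector.nil A)
  | Vector.cons _ a _ v' =>
      match a, all_some v' with
      | Some b, Some w => Some (Vector.cons A b _ w)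
      | _, _ => None
      end
  end.

(* [None] exactly when some variable of the term is outside the domain. *)
Fixpoint value (s : assignment) (t : term Sg) : option M :=
  match t with
  | Var x => s x
  | Func f ts =>
      option_map (@func_interp Sg M f) (all_some (Vector.map (value s) ts))
  end.

Definition values (s : assignment) (k : nat) (ts : Vector.t (term Sg) k) :
    Vector.t (option M) k :=
  Vector.map (value s) ts.

(* Tarski truth of literals.  A literal and its negation are both false when
   one of their variables is undefined, a case that never arises for teams and
   positions whose domain contains the free variables. *)
Definition tarski_literal (s : assignment) (positive : bool) (a : atom Sg) :
    Prop :=
  match a with
  | Rel R ts =>
      exists v, all_some (values s ts) = Some v /\
        if positive then @rel_interp Sg M R v else ~ @rel_interp Sg M R v
  | Equal t1 t2 =>
      exists m1 m2, value s t1 = Some m1 /\ value s t2 = Some m2 /\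
        if positive then m1 = m2 else m1 <> m2
  end.

Definition is_team (X : Ensemble assignment) (V : Ensemble var) : Prop :=
  forall s, X s -> Same_set _ (domain s) V.

(* [X[H/x]]; only the values of [H] on [X] matter. *)
Definition supplement (X : Ensemble assignment)
    (H : assignment -> Ensemble M) (x : var) : Ensemble assignment :=
  fun s' => exists s m, X s /\ H s m /\ s' = update s x m.

(* [X[M/x]] *)
Definition duplicate (X : Ensemble assignment) (x : var) :
    Ensemble assignment :=
  fun s' => exists s m, X s /\ s' = update s x m.

(* Lax team semantics.  The sets [Y] and [Z] in the disjunction are
   automatically teams, being subsets of [X]. *)
Fixpoint satisfies (X : Ensemble assignment) (phi : formula Sg) : Prop :=
  match phi with
  | Lit positive a => forall s, X s -> tarski_literal s positive a
  | Incl ts1 ts2 =>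
      forall s, X s -> exists s', X s' /\ values s ts1 = values s' ts2
  | Excl ts1 ts2 =>
      forall s s', X s -> X s' -> values s ts1 <> values s' ts2
  | And psi theta => satisfies X psi /\ satisfies X theta
  | Or psi theta =>
      exists Y Z, Same_set _ X (Union _ Y Z) /\
        satisfies Y psi /\ satisfies Z theta
  | Ex x psi =>
      exists H : assignment -> Ensemble M,
        (forall s, X s -> Inhabited _ (H s)) /\
        satisfies (supplement X H x) psi
  | All x psi => satisfies (duplicate X x) psi
  end.

Inductive player := I | II.

Section Game.
Variables (phi : formula Sg) (X : Ensemble assignment).

Definition position : Type := occurrence * assignment.

Definition pos_formula (p : position) : option (formula Sg) :=
  subformula_at phi (fst p).

Definition is_position (p : position) : Prop :=
  exists psi, pos_formula p = Some psi /\
    forall x, free x psi -> domain (snd p) x.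

Definition initial (p : position) : Prop := exists s, X s /\ p = ([], s).

Definition terminal (p : position) : Prop :=
  match pos_formula p with
  | Some (Lit _ _ | Incl _ _ | Excl _ _) => True
  | _ => False
  end.

Definition successors (p : position) : Ensemble position :=
  let (o, s) := p in
  match pos_formula p with
  | Some (And _ _ | Or _ _) =>
      fun q => q = (GoLeft :: o, s) \/ q = (GoRight :: o, s)
  | Some (Ex x _ | All x _) =>
      fun q => exists m, q = (GoBody :: o, update s x m)
  | _ => Empty_set _
  end.

Definition active (p : position) : option player :=
  match pos_formula p with
  | Some (Or _ _ | Ex _ _) => Some II
  | Some (And _ _ | All _ _) => Some I
  | _ => None
  end.

Definition winning_for_II (p : position) : Prop :=
  match pos_formula p with
  | Some (Lit positive a) => tarski_literal (snd p) positive a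
  | Some (Incl _ _ | Excl _ _) => True
  | _ => False
  end.

Definition is_play (l : list position) : Prop :=
  (exists p, nth_error l 0 = Some p /\ initial p) /\
  forall i p q, nth_error l i = Some p -> nth_error l (S i) = Some q ->
    successors p q.

Definition ends_at (l : list position) (p : position) : Prop :=
  exists l', l = l' ++ [p].

Definition complete (l : list position) : Prop :=
  exists p, ends_at l p /\ terminal p.

Definition play_winning_for_II (l : list position) : Prop :=
  exists p, ends_at l p /\ winning_for_II p.

(* Only the values at the positions where [II] is active matter. *)
Definition is_strategy (tau : position -> Ensemble position) : Prop :=
  forall p, is_position p -> active p = Some II ->
    Inhabited _ (tau p) /\ Included _ (tau p) (successors p).

Definition follows (tau : position -> Ensemble position)
    (l : list position) : Prop :=
  forall i p q, nth_error l i = Some p -> nth_error l (S i) = Some q ->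
    active p = Some II -> tau p q.

Definition winning (tau : position -> Ensemble position) : Prop :=
  forall l, is_play l -> complete l -> follows tau l -> play_winning_for_II l.

Definition uniform (tau : position -> Ensemble position) : Prop :=
  forall l o s, is_play l -> complete l -> follows tau l -> ends_at l (o, s) ->
    (forall k (ts1 ts2 : Vector.t (term Sg) k),
      subformula_at phi o = Some (Incl ts1 ts2) ->
      exists l' s', is_play l' /\ follows tau l' /\ ends_at l' (o, s') /\
        values s' ts2 = values s ts1) /\
    (forall k (ts1 ts2 : Vector.t (term Sg) k),
      subformula_at phi o = Some (Excl ts1 ts2) ->
      forall l' s', is_play l' -> follows tau l' -> ends_at l' (o, s') ->
        values s ts1 <> values s' ts2).

Definition has_uniform_winning_strategy : Prop :=
  exists tau, is_strategy tau /\ winning tau /\ uniform tau.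

End Game.
End Semantics.

(* Main.v *)
(** Both directions attach a team to every occurrence of a subformula so that
    the teams of the immediate subformulas arise from the team of the formula
    as the lax semantics prescribes.  From a uniform winning strategy, take at
    [o] the assignments [s] for which [(o, s)] is reached by a play following
    the strategy: winning and uniformity say that the terminal formulas hold in
    their teams, and truth propagates up to the root.  Conversely, when
    [satisfies X phi], choose the witnessing teams from the root downwards and
    let player II stay inside them; the positions reached are then exactly those
    in the teams, so truth of the atoms gives winning and uniformity. *)

Require Import Defs.
From Stdlib Require Import Arith Lia List Ensembles.
From Stdlib Require Import Classical ClassicalEpsilon.
Import ListNotations.

Set Implicit Arguments.
Unset Strict Implicit.

(** * Lists whose neighbouring entries are related *)

(** The successor condition in [is_play] and all of [follows] have this form up to conversion, so
    one lemma on appending a last entry serves both. *)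
Definition adjacent (A : Type) (R : A -> A -> Prop) (l : list A) : Prop :=
  forall i p q, nth_error l i = Some p -> nth_error l (S i) = Some q -> R p q.

Lemma adjacent_singleton (A : Type) (R : A -> A -> Prop) (p : A) :
  adjacent R [p].
Proof. intros [|[|i]] a b Ha Hb; discriminate. Qed.

Lemma adjacent_snoc (A : Type) (R : A -> A -> Prop) (l : list A) (p q : A) :
  adjacent R ((l ++ [p]) ++ [q]) <-> adjacent R (l ++ [p]) /\ R p q.
Proof.
  split.
  - intros H; split.
    + intros i a b Ha Hb.
      apply (H i); rewrite nth_error_app1; auto;
        apply nth_error_Some; congruence.
    + apply (H (length l)).
      * rewrite <- app_assoc, nth_error_app2, Nat.sub_diag; auto.
      * rewrite nth_error_app2, length_app, Nat.add_1_r, Nat.sub_diag; auto.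
        rewrite length_app, Nat.add_1_r; auto.
  - intros [H Hpq] i a b Ha Hb.
    assert (Hi : S i < length ((l ++ [p]) ++ [q]))
      by (apply nth_error_Some; congruence).
    rewrite !length_app, !Nat.add_1_r in Hi.
    apply Nat.lt_succ_r, Nat.lt_eq_cases in Hi as [Hi | Hi].
    + rewrite nth_error_app1 in Ha, Hb by
        (rewrite length_app, Nat.add_1_r; lia).
      eapply H; eassumption.
    + injection Hi as ->.
      rewrite <- app_assoc, nth_error_app2, Nat.sub_diag in Ha; auto.
      rewrite nth_error_app2, length_app, Nat.add_1_r, Nat.sub_diag in Hb
        by (rewrite length_app, Nat.add_1_r; auto).
      injection Ha as <-; injection Hb as <-; exact Hpq.
Qed.

(** * One-step decomposition of lax satisfaction *)

Section Satisfaction.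
Variables (Sg : signature) (M : model Sg).
Implicit Types (X Y Z : Ensemble (assignment M)) (psi theta : formula Sg).

(** Teams built in different ways are compared pointwise rather than by equality; this lemma carries
    truth across such comparisons. *)
Lemma satisfies_ext psi X Y :
  (forall s, X s <-> Y s) -> satisfies X psi -> satisfies Y psi.
Proof.
  revert X Y.
  induction psi as [b a|k ts1 ts2|k ts1 ts2|psi1 IH1 psi2 IH2|psi1 IH1 psi2 IH2
    |x psi IH|x psi IH]; simpl; intros X Y E H.
  - intros s Hs; apply H, E, Hs.
  - intros s Hs; destruct (H s) as (s' & Hs' & Hv); [apply E, Hs|].
    exists s'; split; [apply E, Hs'|exact Hv].
  - intros s s' Hs Hs'; apply H; apply E; assumption.
  - destruct H as [H1 H2]; split; [eapply IH1|eapply IH2]; eauto.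
  - destruct H as (Y1 & Y2 & [HI HI'] & H1 & H2).
    exists Y1, Y2; split; [|auto].
    split; intros s Hs; [apply HI, E, Hs|apply E, HI', Hs].
  - destruct H as (H & Hne & Hsat); exists H; split.
    + intros s Hs; apply Hne, E, Hs.
    + revert Hsat; apply IH; intros s'; split;
        intros (s & m & Hs & Hm); exists s, m; split; auto; apply E, Hs.
  - revert H; apply IH; intros s'; split;
      intros (s & m & Hs & Hm); exists s, m; split; auto; apply E, Hs.
Qed.

(** One clause of the lax semantics with the truth of the subformulas removed: [f d] is the team
    handed to the immediate subformula in direction [d]. Both directions of the theorem produce or
    consume families of teams of this kind. *)
Definition splits (psi : formula Sg) (Y : Ensemble (assignment M))
    (f : step -> Ensemble (assignment M)) : Prop :=
  match psi with
  | And _ _ => forall s, (f GoLeft s <-> Y s) /\ (f GoRight s <-> Y s)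
  | Or _ _ => forall s, Y s <-> f GoLeft s \/ f GoRight s
  | Ex x _ => exists H : assignment M -> Ensemble M,
      (forall s, Y s -> Inhabited _ (H s)) /\
      forall s, f GoBody s <-> supplement Y H x s
  | All x _ => forall s, f GoBody s <-> duplicate Y x s
  | _ => True
  end.

Lemma satisfies_splits psi Y :
  satisfies Y psi -> exists f, splits psi Y f /\
    forall d theta, child d psi = Some theta -> satisfies (f d) theta.
Proof.
  destruct psi as [b a|k ts1 ts2|k ts1 ts2|psi1 psi2|psi1 psi2|x psi|x psi];
    simpl; intros H.
  1-3: exists (fun _ => Y); split; [exact Logic.I|intros []; discriminate].
  - exists (fun _ => Y); split; [tauto|].
    intros [] theta [= <-]; apply H.
  - destruct H as (Y1 & Y2 & [HI HI'] & H1 & H2).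
    exists (fun d => match d with GoLeft => Y1 | _ => Y2 end); split.
    + intros s; split.
      * intros Hs; destruct (HI s Hs); auto.
      * intros [Hs | Hs]; apply HI'; [left|right]; exact Hs.
    + intros [] theta [= <-]; assumption.
  - destruct H as (H & Hne & Hsat).
    exists (fun _ => supplement Y H x); split.
    + exists H; split; [exact Hne|tauto].
    + intros [] theta [= <-]; exact Hsat.
  - exists (fun _ => duplicate Y x); split; [tauto|].
    intros [] theta [= <-]; exact H.
Qed.

(** The first hypothesis excludes literals and atoms, on which [splits] imposes nothing: every
    compound formula has a left child or a body. *)
Lemma splits_satisfies psi Y (f : step -> Ensemble (assignment M)) :
  (child GoLeft psi <> None \/ child GoBody psi <> None) ->
  splits psi Y f ->
  (forall d theta, child d psi = Some theta -> satisfies (f d) theta) ->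
  satisfies Y psi.
Proof.
  destruct psi as [b a|k ts1 ts2|k ts1 ts2|psi1 psi2|psi1 psi2|x psi|x psi];
    simpl; intros Hc Hf Hsat; try tauto.
  - split; [apply (@satisfies_ext _ (f GoLeft))|apply (@satisfies_ext _ (f GoRight))];
      try (intros s; apply Hf); apply Hsat; reflexivity.
  - exists (f GoLeft), (f GoRight); split; [|split; apply Hsat; reflexivity].
    split; intros s Hs.
    + apply Hf in Hs as [Hs | Hs]; [left|right]; exact Hs.
    + apply Hf; destruct Hs; auto.
  - destruct Hf as (H & Hne & Hf); exists H; split; [exact Hne|].
    apply (satisfies_ext Hf), Hsat; reflexivity.
  - apply (satisfies_ext Hf), Hsat; reflexivity.
Qed.

End Satisfaction.

(** * Positions reached by plays that follow a strategy *)

Section Reachability.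
Variables (Sg : signature) (M : model Sg) (phi : formula Sg).
Variables (X : Ensemble (assignment M)) (tau : position M -> Ensemble (position M)).

(** The last positions of plays following [tau], in a form that allows induction along the play
    without handling lists. *)
Inductive reachable : position M -> Prop :=
| reachable_initial p : initial X p -> reachable p
| reachable_step p q : reachable p -> successors phi p q ->
    (active phi p = Some II -> tau p q) -> reachable q.

Lemma reachable_play p :
  reachable p <->
  exists l, is_play phi X l /\ follows phi tau l /\ ends_at l p.
Proof.
  split.
  - induction 1 as [p Hp|p q _ (l & [Hi Hs] & Hf & (l' & ->)) Hpq Ht].
    + exists [p]; repeat split; try apply adjacent_singleton.
      * exists p; auto.
      * exists []; reflexivity.
    + exists ((l' ++ [p]) ++ [q]); repeat split.
      * destruct Hi as (p0 & H0 & Hp0); exists p0; split; [|exact Hp0].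
        destruct l'; exact H0.
      * apply adjacent_snoc; auto.
      * apply (@adjacent_snoc _ (fun p q => active phi p = Some II -> tau p q));
          auto.
      * exists (l' ++ [p]); reflexivity.
  - intros (l & Hl & Hf & (l' & ->)).
    revert p Hl Hf; induction l' as [|p' l' IH] using rev_ind;
      intros p [(p0 & H0 & Hp0) Hs] Hf.
    + injection H0 as ->; constructor; exact Hp0.
    + apply adjacent_snoc in Hs as [Hs Hpq].
      apply (@adjacent_snoc _ (fun p q => active phi p = Some II -> tau p q))
        in Hf as [Hf Ht].
      apply (@reachable_step p'); auto.
      apply IH; [|exact Hf].
      split; [|exact Hs].
      exists p0; split; [|exact Hp0].
      destruct l'; exact H0.
Qed.

Lemma successors_occurrence (p q : position M) :
  successors phi p q -> exists d, fst q = d :: fst p.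
Proof.
  destruct p as [o s]; simpl; unfold pos_formula; simpl.
  destruct (subformula_at phi o) as [[]|]; try contradiction;
    [intros [-> | ->]|intros [-> | ->]|intros [m ->]|intros [m ->]];
    eexists; reflexivity.
Qed.

Lemma reachable_nil s : reachable ([], s) <-> X s.
Proof.
  split.
  - inversion 1 as [p (s' & Hs & E)|p q _ Hpq _].
    { injection E as ->; exact Hs. }
    apply successors_occurrence in Hpq as [d [=]].
  - intros Hs; apply reachable_initial; exists s; auto.
Qed.

(** Every move prepends one step to the occurrence, so a position fixes the occurrence of its
    predecessor, and only the earlier assignment remains to be found. *)
Lemma reachable_cons d o s' :
  reachable (d :: o, s') -> exists s, reachable (o, s) /\
    successors phi (o, s) (d :: o, s') /\
    (active phi (o, s) = Some II -> tau (o, s) (d :: o, s')).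
Proof.
  inversion 1 as [p (s & _ & E)|[o' s] q Hr Hpq Ht]; [discriminate|subst].
  pose proof (successors_occurrence Hpq) as [d' [= -> ->]].
  exists s; auto.
Qed.

(** [is_strategy] constrains [tau] only at genuine positions. Moving below a quantifier frees at
    most the quantified variable, which [update] has just defined. *)
Lemma reachable_position (p : position M) :
  (forall s, X s -> Included _ (fun x => free x phi) (domain s)) ->
  reachable p -> is_position phi p.
Proof.
  intros HX; induction 1 as [p (s & Hs & ->)|[o s] q _ (psi & Hpsi & Hfr) Hpq _].
  - exists phi; split; [reflexivity|exact (HX s Hs)].
  - unfold is_position, pos_formula in *; simpl in *.
    unfold pos_formula in Hpq; simpl in Hpq; rewrite Hpsi in Hpq.
    destruct psi as [b a|k ts1 ts2|k ts1 ts2|psi1 psi2|psi1 psi2|x psi|x psi];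
      try contradiction; simpl in Hfr.
    1-2: destruct Hpq as [-> | ->]; simpl; rewrite Hpsi; simpl;
      (eexists; split; [reflexivity|intros; apply Hfr; auto]).
    all: destruct Hpq as [m ->]; simpl; rewrite Hpsi; simpl;
      exists psi; split; [reflexivity|]; intros y Hy;
      unfold domain, update in *; destruct (Nat.eq_dec y x);
      [discriminate|apply Hfr; auto].
Qed.

Definition reachable_team (o : occurrence) : Ensemble (assignment M) :=
  fun s => reachable (o, s).

(** The moves of player I are unrestricted, so conjunctions pass on their whole team and universal
    formulas the full duplicate. For player II, nonemptiness of [tau] makes the two teams of a
    disjunction cover its team and supplies a value for each existential. *)
Lemma reachable_splits o psi :
  (forall s, X s -> Included _ (fun x => free x phi) (domain s)) ->
  is_strategy phi tau -> subformula_at phi o = Some psi ->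
  splits psi (reachable_team o) (fun d => reachable_team (d :: o)).
Proof.
  intros HX Hst Hpsi; unfold reachable_team.
  assert (Hact : forall s : assignment M, active phi (o, s) = match psi with
      Or _ _ | Ex _ _ => Some II | And _ _ | All _ _ => Some I | _ => None end)
    by (intros s; unfold active, pos_formula; simpl; rewrite Hpsi; reflexivity).
  assert (Hsucc : forall (s : assignment M) q, successors phi (o, s) q <-> match psi with
      And _ _ | Or _ _ => q = (GoLeft :: o, s) \/ q = (GoRight :: o, s)
    | Ex x _ | All x _ => exists m, q = (GoBody :: o, update s x m)
    | _ => False end).
  { intros s q; simpl; unfold pos_formula; simpl; rewrite Hpsi.
    destruct psi; try reflexivity; split; intros []. }
  assert (Hmove : forall s : assignment M, reachable (o, s) -> active phi (o, s) = Some II ->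
      exists q, successors phi (o, s) q /\ tau (o, s) q /\ reachable q).
  { intros s Hs Ha.
    destruct (Hst _ (reachable_position HX Hs) Ha) as [[q Hq] Hinc].
    exists q; split; [apply Hinc, Hq|]; split; [exact Hq|].
    apply (reachable_step Hs); auto. apply Hinc, Hq. }
  destruct psi as [b a|k ts1 ts2|k ts1 ts2|psi1 psi2|psi1 psi2|x psi|x psi];
    simpl; auto.
  - intros s; split; split; intros Hs.
    1,3: apply reachable_cons in Hs as (s0 & Hs & Hq & _);
      apply Hsucc in Hq as [[= <-] | [= <-]]; exact Hs.
    all: apply (reachable_step Hs); [apply Hsucc; auto|];
      rewrite Hact; discriminate.
  - intros s; split.
    + intros Hs; destruct (Hmove s Hs (Hact s)) as (q & Hq & _ & Hr).
      apply Hsucc in Hq as [-> | ->]; auto.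
    + intros [Hs | Hs]; apply reachable_cons in Hs as (s0 & Hs & Hq & _);
        apply Hsucc in Hq as [[= <-] | [= <-]]; exact Hs.
  (* The supplementing function offers exactly the values to which [tau] may move. *)
  - exists (fun s m => tau (o, s) (GoBody :: o, update s x m)); split.
    + intros s Hs; destruct (Hmove s Hs (Hact s)) as (q & Hq & Ht & _).
      apply Hsucc in Hq as [m ->]; exists m; exact Ht.
    + intros s'; split.
      * intros Hs; apply reachable_cons in Hs as (s & Hs & Hq & Ht).
        specialize (Ht (Hact s)).
        apply Hsucc in Hq as [m [= ->]]; exists s, m; auto.
      * intros (s & m & Hs & Ht & ->); apply (reachable_step Hs); auto.
        apply Hsucc; exists m; reflexivity.
  - intros s'; split.
    + intros Hs; apply reachable_cons in Hs as (s & Hs & Hq & _).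
      apply Hsucc in Hq as [m [= ->]]; exists s, m; auto.
    + intros (s & m & Hs & ->); apply (reachable_step Hs).
      * apply Hsucc; exists m; reflexivity.
      * rewrite Hact; discriminate.
Qed.

(** Winning and uniformity speak of complete plays; having neither a left child nor a body makes the
    reached position terminal. *)
Lemma terminal_play o s psi :
  reachable (o, s) -> subformula_at phi o = Some psi ->
  child GoLeft psi = None -> child GoBody psi = None ->
  exists l, is_play phi X l /\ complete phi l /\ follows phi tau l /\
    ends_at l (o, s).
Proof.
  intros Hs Hpsi H1 H2; apply reachable_play in Hs as (l & Hl & Hf & He).
  exists l; repeat split; auto; try apply Hl.
  exists (o, s); split; [exact He|].
  unfold terminal, pos_formula; simpl; rewrite Hpsi.
  destruct psi; try discriminate; exact Logic.I.
Qed.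

(** Structural induction with [o] kept general, since the occurrence lengthens on passing to
    subformulas. Winning settles literals, uniformity settles the two kinds of atoms, and
    [reachable_splits] the compound cases. *)
Lemma reachable_satisfies :
  (forall s, X s -> Included _ (fun x => free x phi) (domain s)) ->
  is_strategy phi tau -> winning phi X tau -> uniform phi X tau ->
  forall psi o, subformula_at phi o = Some psi ->
  satisfies (reachable_team o) psi.
Proof.
  intros HX Hst Hwin Huni psi.
  induction psi as [b a|k ts1 ts2|k ts1 ts2|psi1 IH1 psi2 IH2|psi1 IH1 psi2 IH2
    |x psi IH|x psi IH]; intros o Ho.
  4-7: apply (@splits_satisfies _ _ _ _ (fun d => reachable_team (d :: o)));
    [simpl; (left; discriminate) || (right; discriminate)
    |apply reachable_splits; assumption|];
    intros [] theta [= <-]; (apply IH1 || apply IH2 || apply IH);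
    simpl; rewrite Ho; reflexivity.
  - intros s Hs.
    destruct (terminal_play Hs Ho) as (l & Hl & Hc & Hf & He); auto.
    destruct (Hwin l Hl Hc Hf) as (p & Hp & Hw).
    destruct He as [l1 ->], Hp as [l2 Hp].
    apply app_inj_tail in Hp as [_ <-].
    unfold winning_for_II, pos_formula in Hw; simpl in Hw; rewrite Ho in Hw.
    exact Hw.
  - intros s Hs.
    destruct (terminal_play Hs Ho) as (l & Hl & Hc & Hf & He); auto.
    destruct (Huni l o s Hl Hc Hf He) as [Hu _].
    destruct (Hu _ _ _ Ho) as (l' & s' & Hl' & Hf' & He' & Hv).
    exists s'; split; [|auto].
    apply reachable_play; exists l'; auto.
  - intros s s' Hs Hs'.
    destruct (terminal_play Hs Ho) as (l & Hl & Hc & Hf & He); auto.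
    destruct (Huni l o s Hl Hc Hf He) as [_ Hu].
    apply reachable_play in Hs' as (l' & Hl' & Hf' & He').
    exact (Hu _ _ _ Ho _ _ Hl' Hf' He').
Qed.

End Reachability.

(** * Choosing a tree of teams for a true formula *)

Lemma satisfies_team_tree (Sg : signature) (M : model Sg) (phi : formula Sg)
    (X : Ensemble (assignment M)) :
  satisfies X phi ->
  exists T : occurrence -> Ensemble (assignment M), T [] = X /\
    forall o psi, subformula_at phi o = Some psi ->
      satisfies (T o) psi /\ splits psi (T o) (fun d => T (d :: o)).
Proof.
  intros Hsat.
  (* The truth assumption stands inside the existential, so that the choice function [F] is total
     and [T] can be defined before its teams are known to satisfy anything. False formulas receive a
     dummy value. *)
  assert (HF : forall a : formula Sg * Ensemble (assignment M),
      exists f, satisfies (snd a) (fst a) -> splits (fst a) (snd a) f /\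
      forall d theta, child d (fst a) = Some theta -> satisfies (f d) theta).
  { intros [psi Y]; simpl; destruct (classic (satisfies Y psi)) as [H | H].
    - destruct (satisfies_splits H) as [f Hf]; exists f; auto.
    - exists (fun _ => Y); contradiction. }
  pose (F a := proj1_sig (constructive_indefinite_description _ (HF a))).
  (* Below a path that is not an occurrence, [X] is a dummy value. *)
  pose (T := fix T (o : occurrence) := match o with
    | [] => X
    | d :: o' => match subformula_at phi o' with
        | Some psi => F (psi, T o') d
        | None => X
        end
    end).
  assert (HT : forall o psi, subformula_at phi o = Some psi ->
      satisfies (T o) psi).
  { induction o as [|d o IH]; simpl; intros theta Htheta.
    - injection Htheta as <-; exact Hsat.
    - destruct (subformula_at phi o) as [psi|]; [|discriminate].
      apply (proj2_sig (constructive_indefinite_description _ (HF (psi, T o))));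
        simpl; auto. }
  exists T; split; [reflexivity|]; intros o psi Ho; split; [auto|].
  simpl; rewrite Ho.
  apply (proj2_sig (constructive_indefinite_description _ (HF (psi, T o))));
    simpl; auto.
Qed.

(** * The strategy of staying inside a tree of teams *)

Section StrategyOfTeams.
Variables (Sg : signature) (M : model Sg) (phi : formula Sg).
Variables (X : Ensemble (assignment M)) (T : occurrence -> Ensemble (assignment M)).
Hypothesis T_nil : T [] = X.
Hypothesis T_splits : forall o psi, subformula_at phi o = Some psi ->
  splits psi (T o) (fun d => T (d :: o)).

(* A strategy must also move at positions outside the teams, where every
   successor is allowed. *)
Definition team_strategy (p : position M) : Ensemble (position M) :=
  fun q => successors phi p q /\ (T (fst p) (snd p) -> T (fst q) (snd q)).

Lemma team_strategy_is_strategy : is_strategy phi team_strategy.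
Proof.
  intros [o s] (psi & Hpsi & _) Ha; split; [|intros q Hq; apply Hq].
  unfold team_strategy, active, pos_formula in *; simpl in *.
  unfold pos_formula; simpl; specialize (T_splits Hpsi).
  rewrite Hpsi in *; destruct psi as [| | | |psi1 psi2|x psi|];
    try discriminate; simpl in T_splits.
  (* Go left if the left team contains [s]; otherwise the covering forces [s] into the right team
     whenever it lies in [T o]. *)
  - destruct (classic (T (GoLeft :: o) s)) as [HL | HL].
    + exists (GoLeft :: o, s); split; auto.
    + exists (GoRight :: o, s); split; [auto|].
      intros Hs; apply T_splits in Hs; tauto.
  - destruct T_splits as (H & Hne & HB).
    destruct (classic (T o s)) as [Hs | Hs].
    + destruct (Hne s Hs) as [m Hm].
      exists (GoBody :: o, update s x m); split; [exists m; reflexivity|].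
      intros _; apply HB; exists s, m; auto.
    (* Outside the team any value is allowed, and the domain is nonempty. *)
    + destruct (two_elements M) as (m & _).
      exists (GoBody :: o, update s x m); split; [exists m; reflexivity|].
      contradiction.
Qed.

(** Play stays in the teams: player II by choice, player I because conjunctions and universal
    formulas pass on everything. Conversely, each member of a child's team arises by a move from a
    member of the parent's, and the strategy permits that move because it ends inside a team. Off
    the syntax tree [T] is unconstrained, hence the hypothesis on [o]. *)
Lemma team_strategy_reachable o s :
  subformula_at phi o <> None ->
  reachable phi X team_strategy (o, s) <-> T o s.
Proof.
  revert s; induction o as [|d o IH]; intros s.
  - intros _; rewrite reachable_nil, T_nil; reflexivity.
  - simpl; destruct (subformula_at phi o) as [psi|] eqn:Hpsi; [|congruence].
    intros Hd; specialize (T_splits Hpsi).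
    assert (IH' : forall s, reachable phi X team_strategy (o, s) <-> T o s)
      by (intros s'; apply IH; congruence).
    split.
    + intros Hs; apply reachable_cons in Hs as (s0 & Hs & Hq & Ht).
      apply IH' in Hs.
      unfold team_strategy, active, pos_formula in Ht; simpl in Ht, Hq.
      unfold pos_formula in Hq; simpl in Hq; rewrite Hpsi in Ht, Hq.
      destruct psi as [| | |psi1 psi2|psi1 psi2|x psi|x psi];
        try contradiction; simpl in T_splits.
      * destruct Hq as [[= -> ->] | [= -> ->]]; apply T_splits, Hs.
      * apply Ht; auto.
      * apply Ht; auto.
      * destruct Hq as [m [= -> ->]]; apply T_splits; exists s0, m; auto.
    + intros Hs.
      assert (Hback : exists s0, T o s0 /\ successors phi (o, s0) (d :: o, s)).
      { simpl; unfold pos_formula; simpl; rewrite Hpsi.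
        destruct psi as [| | |psi1 psi2|psi1 psi2|x psi|x psi];
          simpl in T_splits, Hd; destruct d; try contradiction.
        1-4: exists s; pose proof (@T_splits s); intuition.
        - destruct T_splits as (H & _ & HB).
          apply HB in Hs; destruct Hs as (s0 & m & Hs0 & Hm & ->).
          exists s0; split; [exact Hs0|exists m; reflexivity].
        - apply T_splits in Hs as (s0 & m & Hs0 & ->).
          exists s0; split; [exact Hs0|exists m; reflexivity]. }
      destruct Hback as (s0 & Hs0 & Hq).
      apply (@reachable_step _ _ _ _ _ (o, s0)); [apply IH', Hs0|exact Hq|].
      intros _; split; auto.
Qed.

Hypothesis T_satisfies : forall o psi, subformula_at phi o = Some psi ->
  satisfies (T o) psi.

Lemma team_strategy_winning : winning phi X team_strategy.
Proof.
  intros l Hl ([o s] & He & Ht) Hf; exists (o, s); split; [exact He|].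
  assert (Hr : reachable phi X team_strategy (o, s))
    by (apply reachable_play; exists l; auto).
  unfold terminal, winning_for_II, pos_formula in *; simpl in *.
  destruct (subformula_at phi o) as [psi|] eqn:Hpsi; [|contradiction].
  apply team_strategy_reachable in Hr; [|congruence].
  specialize (T_satisfies Hpsi).
  destruct psi; try contradiction; auto.
Qed.

Lemma team_strategy_uniform : uniform phi X team_strategy.
Proof.
  intros l o s Hl _ Hf He.
  assert (Hr : reachable phi X team_strategy (o, s))
    by (apply reachable_play; exists l; auto).
  split; intros k ts1 ts2 Ho; pose proof (T_satisfies Ho) as Hsat;
    (apply team_strategy_reachable in Hr; [|congruence]).
  - destruct (Hsat s Hr) as (s' & Hs' & Hv).
    apply team_strategy_reachable in Hs'; [|congruence].
    apply reachable_play in Hs' as (l' & Hl' & Hf' & He').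
    exists l', s'; auto.
  - intros l' s' Hl' Hf' He'; apply Hsat; [exact Hr|].
    apply team_strategy_reachable; [congruence|].
    apply reachable_play; exists l'; auto.
Qed.

End StrategyOfTeams.

(** * Equivalence of game and team semantics *)

Theorem theorem5p10 (Sg : signature) (M : model Sg) (phi : formula Sg)
    (X : Ensemble (assignment M)) (V : Ensemble var)
    (HX : is_team X V) (HV : forall x, free x phi -> V x) :
  has_uniform_winning_strategy phi X <-> satisfies X phi.
Proof.
  split.
  - intros (tau & Hst & Hwin & Huni).
    apply (@satisfies_ext _ _ _ (reachable_team phi X tau [])).
    + intros s; apply reachable_nil.
    + apply reachable_satisfies; auto.
      intros s Hs x Hx; apply (HX s Hs), HV, Hx.
  - intros Hsat; destruct (satisfies_team_tree Hsat) as (T & HT0 & HT).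
    exists (team_strategy phi T); split; [|split].
    + apply team_strategy_is_strategy; apply HT.
    + apply team_strategy_winning; auto; apply HT.
    + apply team_strategy_uniform; auto; apply HT.
Qed.
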